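(* Fix a graph with $N$ nodes and $n_b$ bonds, a choice of pinned degrees of freedom, and index sets $T,S$ among the remaining (free) ones, and write $X=(x_1,\dots,x_N)\in\mathbb{R}^{2N}$ for the stacked node positions. If a single $(X_0,\kappa_0)$ with $\kappa_0>0$ (and $K_{ff}$ invertible there) satisfies $\operatorname{rank}J=\min(n_b,d)$, then there is a non-zero polynomial $F$ on $\mathbb{R}^{2N}\times\mathbb{R}^{n_b}$ such that $\operatorname{rank}J=\min(n_b,d)$ at every admissible $(X,\kappa)$ with $F(X,\kappa)\ne0$. The excluded set has Lebesgue measure zero and empty interior.
   Context: For a bond $b=(i,j)$ let $\check q_b\in\mathbb{R}^{2N}$ carry $-(x_j-x_i)$ at node $i$, $+(x_j-x_i)$ at node $j$ and zeros elsewhere. For $\kappa=(\kappa_b)\in\mathbb{R}^{n_b}$ put $K=\sum_b\kappa_b\check q_b\check q_b^{T}$ (this is the spring-network stiffness matrix with bond stiffnesses $k_b=\kappa_bL_b^2$, $L_b=|x_j-x_i|$). Three degrees of freedom (coordinates) are pinned to remove the planar rigid-body modes; $K_{ff}$ is the restriction of $K$ to the $n_{\mathrm{free}}=2N-3$ free ones. $(X,\kappa)$ is admissible if $\kappa_b>0$ for all $b$ and $K_{ff}$ is invertible; then $C=K_{ff}^{-1}$. With $|T|=m_T$, $|S|=m_S$, $p=|T\cap S|$, put $R=C[T,S]$, $J=\partial R/\partial\kappa$ (the $m_Tm_S\times n_b$ Jacobian at fixed $X$), and $d=m_Tm_S-\tfrac12p(p-1)$. *)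

(* Defs.v *)
From HB Require Import structures.
From mathcomp Require Import all_boot all_order all_algebra.
(* mpoly.v comes first, and without its notations: both its notations and its
   module Measure clash with MathComp-Analysis. *)
From mathcomp Require Import -(notations) mpoly.
From mathcomp Require Import all_classical all_reals all_analysis.

Set Implicit Arguments.
Unset Strict Implicit.
Unset Printing Implicit Defensive.

Import Order.TTheory GRing.Theory Num.Theory.
Import numFieldNormedType.Exports.

Local Open Scope classical_set_scope.
Local Open Scope ring_scope.

Section lebesgue_tuple.
Context {R : realType}.
Local Notation RT := (measurableTypeR R).

Definition cons_pair n (z : RT * n.-tuple RT) : n.+1.-tuple RT :=
  [tuple of z.1 :: z.2].

Lemma measurable_cons_pair n : measurable_fun setT (@cons_pair n).
Proof. exact: measurable_cons measurable_fst measurable_snd. Qed.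

Definition lebesgue_cons n (mu : {sigma_finite_measure set (n.-tuple RT) -> \bar R})
    : set (n.+1.-tuple RT) -> \bar R :=
  pushforward (lebesgue_measure \x mu)%E (@cons_pair n).

Section lebesgue_cons.
Variables (n : nat) (mu : {sigma_finite_measure set (n.-tuple RT) -> \bar R}).

Let lebesgue_cons0 : lebesgue_cons mu set0 = 0%E.
Proof. by rewrite /lebesgue_cons /pushforward preimage_set0 measure0. Qed.

Let lebesgue_cons_ge0 A : (0 <= lebesgue_cons mu A)%E.
Proof. by rewrite /lebesgue_cons /pushforward; exact: measure_ge0. Qed.

Let lebesgue_cons_sigma_additive : semi_sigma_additive (lebesgue_cons mu).
Proof.
have mc (B : set (n.+1.-tuple RT)) : measurable B -> measurable (@cons_pair n @^-1` B).
  by move=> mB; rewrite -[X in measurable X]setTI; exact: measurable_cons_pair.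
move=> F mF tF mUF; rewrite /lebesgue_cons /pushforward preimage_bigcup.
apply: measure_semi_sigma_additive; first by move=> i; exact: mc.
  apply/trivIsetP => i j _ _ ij; rewrite -preimage_setI.
  by move/trivIsetP : tF => /(_ _ _ _ _ ij) ->//; rewrite preimage_set0.
by rewrite -preimage_bigcup; exact: mc.
Qed.

HB.instance Definition _ := isMeasure.Build _ _ _ (lebesgue_cons mu)
  lebesgue_cons0 lebesgue_cons_ge0 lebesgue_cons_sigma_additive.

Let sigma_finite_lebesgue_cons : sigma_finite setT (lebesgue_cons mu).
Proof.
pose g (t : n.+1.-tuple RT) : RT * n.-tuple RT := (thead t, [tuple of behead t]).
have mg : measurable_fun setT g.
  apply/measurable_fun_pair; first exact: (measurable_tnth ord0).
  exact: measurable_behead.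
have gK z : g (cons_pair z) = z.
  by case: z => x t; rewrite /g /cons_pair theadE; congr pair; apply: val_inj.
have /sigma_finiteP[F [UF ndF mF]] := sigma_finiteT (@lebesgue_measure R).
have /sigma_finiteP[G [UG ndG mG]] := sigma_finiteT mu.
exists (fun k => g @^-1` (F k `*` G k)).
  rewrite -preimage_bigcup (_ : \bigcup_k _ = setT) ?preimage_setT//.
  rewrite -setXTT UF UG predeqE => -[x y]; split => [[k _ []/= ? ?]|].
    by split; exists k.
  move=> [/= [i _ Fix] [j _ Gjy]]; exists (maxn i j) => //; split.
  - by move: x Fix; exact/subsetPset/ndF/leq_maxl.
  - by move: y Gjy; exact/subsetPset/ndG/leq_maxr.
move=> k; have [mFk Fk] := mF k; have [mGk Gk] := mG k.
split; first by rewrite -[X in measurable X]setTI; apply: mg => //; exact: measurableX.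
rewrite /lebesgue_cons /pushforward -comp_preimage.
rewrite (_ : g \o _ = id); last by apply/funext => z; rewrite /= gK.
by rewrite preimage_id product_measure1E// lte_mul_pinfty// ge0_fin_numE.
Qed.

HB.instance Definition _ :=
  Measure_isSigmaFinite.Build _ _ _ (lebesgue_cons mu) sigma_finite_lebesgue_cons.

End lebesgue_cons.

(* Lebesgue measure on the Borel sets of R^n, as the iterated product of the
   one-dimensional one; lebesgue_tuple_box characterizes it. *)
Fixpoint lebesgue_tuple n : {sigma_finite_measure set (n.-tuple RT) -> \bar R} :=
  match n with
  | 0 => \d_([tuple] : 0.-tuple RT)
  | m.+1 => lebesgue_cons (lebesgue_tuple m)
  end.

Lemma lebesgue_tuple_box n (A : 'I_n -> set RT) : (forall i, measurable (A i)) ->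
  lebesgue_tuple n [set t | forall i, A i (tnth t i)] =
  (\prod_(i < n) lebesgue_measure (A i))%E.
Proof.
elim: n A => [|n IH] A mA.
  by rewrite big_ord0 /= diracE mem_set// => -[].
rewrite big_ord_recl /= /lebesgue_cons /pushforward.
pose B : set (n.-tuple RT) := [set t | forall i, A (lift ord0 i) (tnth t i)].
have mB : measurable B.
  rewrite (_ : B = \bigcap_(i in setT) ((@tnth n RT ^~ i) @^-1` A (lift ord0 i))).
    apply: fin_bigcap_measurable => // i _; rewrite -[X in measurable X]setTI.
    exact: measurable_tnth.
  by apply/seteqP; split => t /= Bt i; [move=> _; exact: Bt|exact: Bt].
rewrite (_ : _ @^-1` _ = A ord0 `*` B); first by rewrite product_measure1E// (IH (fun i => A (lift ord0 i))).
apply/seteqP; split => -[x t] /=.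
  move=> h; split; first exact: (h ord0).
  by move=> i; have := h (lift ord0 i); rewrite tnthS /=; congr (A _ _); congr tnth; apply: val_inj.
move=> [h0 h] i; have [->|i0] := eqVneq i ord0; first exact: h0.
case: (unliftP ord0 i) i0 => [j ->|->]; last by rewrite eqxx.
by move=> _; rewrite tnthS; have := h j; congr (A _ _); congr tnth; apply: val_inj.
Qed.

End lebesgue_tuple.

Definition lebesgue_null (R : realType) n (A : set 'rV[R]_n) : Prop :=
  (lebesgue_tuple n).-negligible
    [set t : n.-tuple (measurableTypeR R) | A (\row_i tnth t i)].

(* A simple graph with labelled bonds; the orientation (i, j) chosen for a bond
   is immaterial, as bond_vec below is symmetric in i and j. *)
Record graph (N nb : nat) := Graph {
  ends :> 'I_nb -> 'I_N * 'I_N;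
  ends_neq : forall b, (ends b).1 != (ends b).2;
  ends_inj : forall b c,
    ends c = ends b \/ ends c = ((ends b).2, (ends b).1) -> c = b }.

Section spring_network.
Context {R : realType} {N nb : nat}.
Variable g : graph N nb.

(* The degree of freedom "coordinate a of node i" is mxvec_index i a. *)
Definition node (X : 'rV[R]_(N * 2)) (i : 'I_N) : 'rV[R]_2 := row i (vec_mx X).

Definition bond_vec (X : 'rV[R]_(N * 2)) (b : 'I_nb) : 'cV[R]_(N * 2) :=
  let: (i, j) := g b in
  (mxvec (\matrix_(k < N) (if k == i then - (node X j - node X i)
                           else if k == j then node X j - node X i
                           else 0)))^T.

Definition stiffness (X : 'rV[R]_(N * 2)) (kappa : 'rV[R]_nb) : 'M[R]_(N * 2) :=
  \sum_(b < nb) kappa ord0 b *: (bond_vec X b *m (bond_vec X b)^T).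

Variable pinned : {set 'I_(N * 2)}.

(* The free degrees of freedom, listed in increasing order, are indexed by
   'I_#|~: pinned|. *)
Definition free_stiffness X kappa : 'M[R]_#|~: pinned| :=
  mxsub (@enum_val _ (mem (~: pinned))) (@enum_val _ (mem (~: pinned)))
    (stiffness X kappa).

Definition admissible X (kappa : 'rV[R]_nb) : Prop :=
  (forall b, 0 < kappa ord0 b) /\ free_stiffness X kappa \in unitmx.

Definition compliance X kappa : 'M[R]_#|~: pinned| :=
  invmx (free_stiffness X kappa).

Variables T S : {set 'I_#|~: pinned|}.

Definition response X kappa : 'M[R]_(#|T|, #|S|) :=
  mxsub (@enum_val _ (mem T)) (@enum_val _ (mem S)) (compliance X kappa).

(* The library's jacobian acts on row vectors, whence the transpose. *)
Definition response_jacobian X kappa : 'M[R]_(#|T| * #|S|, nb) :=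
  (jacobian (fun k : 'rV[R]_nb => mxvec (response X k)) kappa)^T.

End spring_network.

(* #|T :&: S| <= #|T|, #|S|, so the truncated subtraction is exact. *)
Definition response_dim n (T S : {set 'I_n}) : nat :=
  (#|T| * #|S| - (#|T :&: S| * (#|T :&: S| - 1))./2)%N.

Definition zero_locus (R : realType) n (F : mpoly n R) : set 'rV[R]_n :=
  [set z | meval (z ord0) F = 0].

(* Main.v *)
(* Write C for the inverse of K_ff and Q_b for the restriction of q_b q_b^T to
   the free coordinates.  Differentiating K_ff C = 1 gives dC/dkappa_b =
   - C Q_b C, and C is the adjugate of K_ff over its determinant, so that up to
   the nonzero factor - det(K_ff)^-2 the Jacobian is a matrix M(X, kappa) with
   polynomial entries, those of adj(K_ff) Q_b adj(K_ff).  These matrices being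
   symmetric, the rows of M indexed by (t, s) and (s, t) agree for t, s in the
   intersection of T and S, whence rank M <= min(n_b, d) everywhere.  For F take
   a minor of M of size min(n_b, d) that does not vanish at (X0, kappa0). *)
Require Import Defs.
From HB Require Import structures.
From mathcomp Require Import all_boot all_order all_algebra.
From mathcomp Require Import -(notations) mpoly.
From mathcomp Require Import all_classical all_reals all_analysis.
From mathcomp Require Import measurable_realfun.

Import Order.TTheory GRing.Theory Num.Theory.
Import numFieldNormedType.Exports.

Local Open Scope classical_set_scope.
Local Open Scope ring_scope.

(** * Zeros of polynomials *)

(** Induction on the size: dividing out ['X - x%:P] at a root [x] lowers the size and loses no root
    but possibly [x]. *)
Lemma finite_set_root (R : idomainType) (p : {poly R}) :
  p != 0 -> finite_set [set x | root p x].
Proof.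
have [n] := ubnP (size p); elim: n p => // n IH p /ltnSE-pn p0.
have [[x px]|noroot] := pselect (exists x, root p x); last first.
  rewrite (_ : mkset _ = set0); first exact: finite_set0.
  by apply/seteqP; split=> // x /= px; apply: noroot; exists x.
have /factor_theorem[q pq] := px.
have q0 : q != 0 by apply: contra_neq p0 => q0; rewrite pq q0 mul0r.
apply: (@sub_finite_set _ _ ([set y | root q y] `|` [set x])).
  by move=> y /=; rewrite pq rootM root_XsubC => /orP[|/eqP]; [left|right].
rewrite finite_setU; split; last exact: finite_set1.
by apply: IH => //; rewrite (leq_trans _ pn)// pq size_Mmonic ?monicXsubC// size_XsubC addn2.
Qed.

(** Serves to freeze the first variable of a polynomial at a constant, which leaves a polynomial in
    the remaining ones. *)
Lemma meval_tuple_subst (R : comNzRingType) (n k : nat) (F : mpoly k R)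
    (h : 'I_k -> mpoly n R) :
  exists G : mpoly n R, forall v, meval v G = meval (fun i => meval v (h i)) F.
Proof.
exists (comp_mpoly [tuple h i | i < k] F) => v.
by rewrite comp_mpoly_meval; apply: meval_eq => i; rewrite tnth_mktuple.
Qed.

(** Serves to restrict a polynomial to a line, where its zeros are the roots of a univariate
    polynomial. *)
Lemma meval_poly_subst (R : comNzRingType) (n : nat) (F : mpoly n R)
    (h : 'I_n -> {poly R}) :
  exists p : {poly R}, forall x, p.[x] = meval (fun i => (h i).[x]) F.
Proof.
exists (mmap polyC h F) => x.
rewrite mevalE horner_sum; apply: eq_bigr => m _.
rewrite hornerM hornerC horner_prod; congr (_ * _); apply: eq_bigr => i _.
exact: horner_exp.
Qed.

Section zero_locus.
Context {R : realType}.
Local Notation RT := (measurableTypeR R).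

Lemma measurable_meval n (F : mpoly n R) :
  measurable_fun setT (fun t : n.-tuple RT => meval (tnth t) F : RT).
Proof.
under eq_fun do rewrite mevalE.
apply: measurable_sum => m; apply: measurable_funM; first exact: measurable_cst.
apply: measurable_prod => i _; apply: measurable_funX.
exact: measurable_tnth.
Qed.

Lemma measurable_meval_zeros n (F : mpoly n R) :
  measurable [set t : n.-tuple RT | meval (tnth t) F = 0].
Proof.
rewrite -[X in measurable X]setTI.
by have := @measurable_meval n F measurableT [set 0] (measurable_set1 _).
Qed.

(* Fubini: the section of the zero set at a first coordinate x is null by
   induction unless x is one of the finitely many roots of F(., a_2, ..., a_n). *)
Lemma lebesgue_tuple_zeros n (F : mpoly n R) (a : n.-tuple RT) :
  meval (tnth a) F != 0 ->
  lebesgue_tuple n [set t : n.-tuple RT | meval (tnth t) F = 0] = 0%E.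
Proof.
elim: n F a => [|n IH] F a Fa.
  (* The only point of the 0-dimensional space is [a], where [F] does not vanish. *)
  rewrite (_ : mkset _ = set0) ?measure0//; apply/seteqP; split=> // t /= Ft.
  by move: Fa; rewrite (tuple0 a) -(tuple0 t) Ft eqxx.
pose Z := @cons_pair R n @^-1` [set t | meval (tnth t) F = 0].
have mZ : measurable Z.
  rewrite -[X in measurable X]setTI; apply: measurable_cons_pair => //.
  exact: measurable_meval_zeros.
rewrite [LHS](_ : _ = (lebesgue_measure \x lebesgue_tuple n)%E Z)//.
pose a' : n.-tuple RT := [tuple of behead a].
(* [p] is [F] with all coordinates but the first frozen at those of [a]; its value at [thead a] is
   F(a), so it is nonzero. *)
have [p pE] : exists p : {poly R}, forall x : R,
    p.[x] = meval (tnth [tuple of x :: a']) F.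
  have [p pE] := meval_poly_subst _ _ F
    (fun i => if unlift ord0 i is Some j then (tnth a' j)%:P else 'X).
  exists p => x; rewrite pE; apply: meval_eq => i.
  case: unliftP => [j|] ->; first by rewrite hornerC tnthS.
  by rewrite hornerX tnth0.
have p0 : p != 0.
  apply: contra_neq Fa => p0.
  have := pE (thead a); rewrite p0 horner0 => ->; congr meval.
  by rewrite [in LHS](tuple_eta a).
rewrite /product_measure1.
rewrite (_ : 0%E = \int[lebesgue_measure]_(x in setT) (cst 0%E x : \bar R))%E;
  last by rewrite integral0.
apply: ge0_ae_eq_integral => //.
  exact: measurable_fun_xsection.
exists [set x | root p x]; split.
- exact/countable_measurable/finite_set_countable/finite_set_root.
- exact/countable_lebesgue_measure0/finite_set_countable/finite_set_root.
- move=> x /=; apply: contra_notT => px _.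
  (* [G] is F(x, .). Its value at [a'] is [p.[x]], nonzero off the roots, so the induction
     hypothesis applies at [a']. *)
  have [G GE] := meval_tuple_subst _ _ _ F
    (fun i => if unlift ord0 i is Some j then mpolyX R (mnm1 j) else mpolyC n x).
  have GxE (t : n.-tuple RT) : meval (tnth t) G = meval (tnth [tuple of x :: t]) F.
    rewrite GE; apply: meval_eq => i.
    case: unliftP => [j|] ->; first by rewrite mevalXU tnthS.
    by rewrite mevalC tnth0.
  rewrite (_ : xsection Z x = [set t | meval (tnth t) G = 0]).
    by apply: (IH _ a'); rewrite GxE -pE.
  by apply/seteqP; split=> t; rewrite /xsection /= ?inE /Z /= GxE ?inE.
Qed.

Lemma lebesgue_null_zero_locus n (F : mpoly n R) (a : 'rV[R]_n) :
  meval (a ord0) F != 0 -> lebesgue_null (zero_locus F).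
Proof.
move=> Fa; exists [set t : n.-tuple RT | meval (tnth t) F = 0]; split.
- exact: measurable_meval_zeros.
- apply: (@lebesgue_tuple_zeros _ _ [tuple a ord0 i | i < n]).
  by apply: contra_neq Fa => <-; apply: meval_eq => i; rewrite tnth_mktuple.
- by move=> t /= <-; apply: meval_eq => i; rewrite mxE.
Qed.

(* If F vanished near z, its restriction to the line through z and a, a nonzero
   polynomial in one variable, would vanish on an interval. *)
Lemma interior_zero_locus n (F : mpoly n R) (a : 'rV[R]_n) :
  meval (a ord0) F != 0 -> interior (zero_locus F) = set0.
Proof.
move=> Fa; apply/seteqP; split=> // z zF.
have [p pE] := meval_poly_subst _ _ F
  (fun i => (z ord0 i)%:P + 'X * (a ord0 i - z ord0 i)%:P).
have {}pE x : p.[x] = meval ((z + x *: (a - z)) ord0) F.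
  by rewrite pE; apply: meval_eq => i; rewrite hornerD hornerM hornerX !hornerC !mxE.
have p0 : p != 0.
  by apply: contra_neq Fa => p0; rewrite -(subrKC z a) -[_ - z]scale1r -pE p0 horner0.
have : \forall x \near (0 : R), root p x.
  have cont : (fun x : R => z + x *: (a - z)) x @[x --> (0 : R)] --> z.
    rewrite [X in _ --> X](_ : z = z + 0 *: (a - z)); last by rewrite scale0r addr0.
    by apply: cvgD; [exact: cvg_cst|apply: cvgZr_tmp; exact: cvg_id].
  have zFx : \forall x \near (0 : R), zero_locus F (z + x *: (a - z)) by exact: (cont _ zF).
  by apply: filterS zFx => x /= Fx; rewrite /root pE; exact/eqP.
case/nbhs_ballP => e /= e0 eroot.
(* The ball lies in the finite root set of [p], which is null, although its measure is twice [e]. *)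
have : (lebesgue_measure (ball (0%R : R) e) <= 0)%E.
  rewrite -(countable_lebesgue_measure0 (finite_set_countable (finite_set_root _ _ p0))).
  apply: le_measure => //; rewrite inE; first exact: measurable_ball.
  exact/countable_measurable/finite_set_countable/finite_set_root.
rewrite lebesgue_measure_ball; last exact: ltW.
by rewrite lee_fin leNgt mulrn_wgt0.
Qed.

End zero_locus.

(** * Derivative of the inverse of a matrix *)

Section matrix_calculus.
Context {R : realType} {V : normedModType R}.

(** The first-order expansion of [f] at [x] is also one of [g], and [diff_unique] identifies its
    linear part as the differential of [g]. *)
Lemma near_eq_differentiable (W : normedModType R) (f g : V -> W) (x : V) :
  {near x, f =1 g} -> differentiable f x -> differentiable g x.
Proof.
move=> fg df; have fgx := nbhs_singleton fg.
have dfc : continuous ('d f x) by exact: diff_continuous.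
have dg : g \o shift x = cst (g x) + 'd f x +o_ 0 id.
  apply/eqaddoP => _/posnumP[e].
  have /eqaddoP/(_ _ [gt0 of e%:num]) := diff_locally df.
  have : \forall h \near (0 : V), f (h + x) = g (h + x).
    have xh : (h + x) @[h --> (0 : V)] --> x.
      rewrite [X in _ --> X](_ : x = 0 + x); last by rewrite add0r.
      by apply: cvgD; [exact: cvg_id|exact: cvg_cst].
    exact: (xh _ fg).
  apply: filterS2 => h fgh; rewrite /= !fctE -fgh -fgx; exact.
apply/diff_locallyP.
by rewrite (diff_unique dfc dg).
Qed.

Lemma differentiable_bigsum (W : normedModType R) (I : Type) (r : seq I) (P : pred I)
    (f : I -> V -> W) x :
  (forall i, P i -> differentiable (f i) x) ->
  differentiable (fun y => \sum_(i <- r | P i) f i y) x.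
Proof.
move=> df; rewrite -fct_sumE; elim/big_ind : _ => //.
by move=> g h dg dh; exact: differentiableD.
Qed.

Lemma differentiable_bigprod (I : Type) (r : seq I) (P : pred I)
    (f : I -> V -> R) x :
  (forall i, P i -> differentiable (f i) x) ->
  differentiable (fun y => \prod_(i <- r | P i) f i y) x.
Proof.
move=> df; rewrite -fct_prodE; elim/big_ind : _ => //.
by move=> g h dg dh; exact: differentiableM.
Qed.

Lemma differentiable_mxP m n (M : V -> 'M[R]_(m, n)) x :
  differentiable M x <-> forall i j, differentiable (fun y => M y i j) x.
Proof.
split=> [dM i j|dM].
  exact: (differentiable_comp dM (differentiable_coord _ i j)).
rewrite (_ : M = fun y => \sum_i \sum_j M y i j *: delta_mx i j); last first.
  by apply/funext => y; rewrite [LHS]matrix_sum_delta.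
apply: differentiable_bigsum => i _; apply: differentiable_bigsum => j _.
exact: differentiableZl.
Qed.

Lemma differentiable_det n (M : V -> 'M[R]_n) x :
  differentiable M x -> differentiable (fun y => \det (M y)) x.
Proof.
move=> /differentiable_mxP dM; apply: differentiable_bigsum => s _.
apply: differentiableM; first exact: differentiable_cst.
by apply: differentiable_bigprod => i _; exact: dM.
Qed.

Lemma near_unitmx n (M : V -> 'M[R]_n) x :
  differentiable M x -> M x \in unitmx -> \forall y \near x, M y \in unitmx.
Proof.
move=> /differentiable_det/differentiable_continuous dc.
rewrite unitmxE unitfE => Mx0.
apply: filterS (cvgr_neq0 _ dc Mx0) => y.
by rewrite unitmxE unitfE.
Qed.

(** Cramer's formula has differentiable entries. [invmx] follows it only on invertible matrices, but
    these include all [M y] with [y] near [x]. *)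
Lemma differentiable_invmx n (M : V -> 'M[R]_n) x :
  differentiable M x -> M x \in unitmx ->
  differentiable (fun y => invmx (M y)) x.
Proof.
move=> dM uM.
apply: (@near_eq_differentiable _ (fun y => (\det (M y))^-1 *: \adj (M y))).
  by apply: filterS (near_unitmx _ _ _ dM uM) => y uy; rewrite /invmx uy.
apply/differentiable_mxP => i j.
under eq_fun do rewrite !mxE.
apply: differentiableM.
  apply: differentiableV; first exact: differentiable_det.
  by rewrite -unitfE -unitmxE.
apply: differentiableM; first exact: differentiable_cst.
apply: differentiable_det; apply/differentiable_mxP => k l.
under eq_fun do rewrite !mxE.
by move/differentiable_mxP : dM; exact.
Qed.

Lemma derive_entry m n (M : V -> 'M[R]_(m, n)) x v i j :
  derivable M x v -> 'D_v (fun y => M y i j) x = ('D_v M x) i j.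
Proof. by move=> dM; rewrite derive_mx// mxE. Qed.

Lemma derive_mulmx m n p (A : V -> 'M[R]_(m, n)) (B : V -> 'M[R]_(n, p)) x v :
  derivable A x v -> derivable B x v ->
  'D_v (fun y => A y *m B y) x = 'D_v A x *m B x + A x *m 'D_v B x.
Proof.
move=> dA dB.
have dAB i j : is_derive x v (fun y => (A y *m B y) i j)
    (('D_v A x *m B x + A x *m 'D_v B x) i j).
  have -> : (fun y => (A y *m B y) i j) =
      \sum_(k < n) ((fun y => A y i k) * (fun y => B y k j)).
    by rewrite fct_sumE; apply/funext => y; rewrite mxE.
  rewrite !mxE -big_split /=.
  have dAk k : derivable (fun y => A y i k) x v by move/derivable_mxP : dA; exact.
  have dBk k : derivable (fun y => B y k j) x v by move/derivable_mxP : dB; exact.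
  rewrite (eq_bigr (fun k => A x i k *: 'D_v (fun y => B y k j) x
      + B x k j *: 'D_v (fun y => A y i k) x)).
    by apply: is_derive_sum => k; apply: is_deriveM; exact: derivableP.
  by move=> k _; rewrite !derive_entry// addrC [X in _ + X]mulrC.
rewrite derive_mx; last by apply/derivable_mxP => i j; exact: ex_derive.
by apply/matrixP => i j; rewrite mxE derive_val.
Qed.

Lemma derive_invmx n (M : V -> 'M[R]_n) x v :
  differentiable M x -> M x \in unitmx ->
  'D_v (fun y => invmx (M y)) x = - (invmx (M x) *m 'D_v M x *m invmx (M x)).
Proof.
move=> dM uM.
have dM' : derivable M x v by exact: diff_derivable.
have dI : derivable (fun y => invmx (M y)) x v.
  by apply: diff_derivable; exact: differentiable_invmx.
have : 'D_v (fun y => M y *m invmx (M y)) x = 0.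
  (* The product is the identity only where [M y] is invertible, hence near [x], which suffices for
     the derivative. *)
  rewrite (@near_eq_derive _ _ _ _ (cst 1%:M)) ?derive_cst//.
  by apply: filterS (near_unitmx _ _ _ dM uM) => y uy; rewrite mulmxV.
rewrite derive_mulmx// addrC => /addr0_eq MI.
rewrite -[LHS](mulKmx uM).
by rewrite -[M x *m _]opprK MI mulmxN mulmxA.
Qed.

End matrix_calculus.

(** * Rank of matrices *)

Section minors.
Variable F : fieldType.

(** Keep a maximal independent family of rows, then as many independent columns of what remains. *)
Lemma minor_of_rank m n r (A : 'M[F]_(m, n)) : \rank A = r ->
  exists (f : 'I_r -> 'I_m) (h : 'I_r -> 'I_n), \det (mxsub f h A) != 0.
Proof.
move=> <-.
pose f := maxrankfun A.
have full : row_full (rowsub f A)^T.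
  by rewrite /row_full mxrank_tr; exact: maxrowsub_free.
have [h hU] : exists h : 'I_(\rank A) -> 'I_n, rowsub h (rowsub f A)^T \in unitmx.
  by exists (fullrankfun full); exact: fullrowsub_unit.
exists f, h; move: hU; rewrite unitmxE unitfE -det_tr !trmx_mxsub trmxK.
by rewrite -mxsub_comp.
Qed.

(** Selecting rows and columns cannot raise the rank, and an invertible selection has rank [r]. *)
Lemma rank_ge_minor m n r (f : 'I_r -> 'I_m) (h : 'I_r -> 'I_n) (A : 'M[F]_(m, n)) :
  \det (mxsub f h A) != 0 -> (r <= \rank A)%N.
Proof.
rewrite -unitfE -unitmxE => /mxrank_unit {1}<-.
rewrite mxsubrc (leq_trans (mxrankS (rowsub_sub _ _)))//.
rewrite -mxrank_tr trmx_mxsub -[leqRHS]mxrank_tr.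
exact/mxrankS/rowsub_sub.
Qed.

End minors.

(** * Rank bound from coinciding rows *)

Section symmetric_pairs.
Variables (n : nat) (T S : {set 'I_n}).
Local Notation tval := (@enum_val _ (mem T)).
Local Notation sval := (@enum_val _ (mem S)).

(* Of the two equal rows (t, s) and (s, t), t and s in T :&: S, the one with
   s < t is dropped. *)
Definition redundant : {set 'I_#|T| * 'I_#|S|} :=
  [set ts | [&& tval ts.1 \in S, sval ts.2 \in T & (sval ts.2 < tval ts.1)%N]].

(** The square of [T :&: S] splits into the diagonal and two triangles exchanged by the swap;
    [redundant] corresponds to one triangle. *)
Lemma card_redundant : #|redundant| = (#|T :&: S| * (#|T :&: S| - 1))./2.
Proof.
pose P := T :&: S.
pose up : {set 'I_n * 'I_n} := [set xy in finset.setX P P | (xy.2 < xy.1)%N].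
pose down : {set 'I_n * 'I_n} := [set xy in finset.setX P P | (xy.1 < xy.2)%N].
pose diag : {set 'I_n * 'I_n} := [set xy in finset.setX P P | xy.1 == xy.2].
have -> : #|redundant| = #|up|.
  (* [e] passes from positions in [T] and [S] to the indices themselves, where the two components
     can be compared and swapped. *)
  pose e (ts : 'I_#|T| * 'I_#|S|) := (tval ts.1, sval ts.2).
  have einj : injective e.
    by move=> [t s] [t' s'] [/enum_val_inj-> /enum_val_inj->].
  rewrite -(card_imset _ einj); apply: eq_card => -[x y].
  apply/imsetP/idP => [[[t s]]|]; rewrite !inE /=.
    move=> /and3P[tS sT lt] [-> ->].
    by rewrite tS sT lt !enum_valP.
  move=> /andP[/andP[/andP[xT xS] /andP[yT yS]] lt].
  exists (enum_rank_in xT x, enum_rank_in yS y).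
    by rewrite !inE /= !enum_rankK_in// xS yT.
  by rewrite /e /= !enum_rankK_in.
have ud : #|down| = #|up|.
  have sw : injective (fun xy : 'I_n * 'I_n => (xy.2, xy.1)).
    by move=> [x y] [x' y'] [-> ->].
  rewrite -(card_imset _ sw); apply: eq_card => -[x y].
  apply/imsetP/idP => [[[x' y']]|]; rewrite !inE /=.
    by move=> /andP[/andP[hx hy] lt] [-> ->]; rewrite hx hy.
  by case/andP=> /andP[/andP[xT xS] /andP[yT yS]] lt; exists (y, x); rewrite ?inE /= ?xT ?xS ?yT ?yS.
have dg : #|diag| = #|P|.
  have dgi : injective (fun x : 'I_n => (x, x)) by move=> x y [].
  rewrite -(card_imset _ dgi); apply: eq_card => -[x y].
  apply/idP/imsetP => [|[x' x'P [-> ->]]].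
    by rewrite !inE /= => /andP[/andP[xP _] /eqP <-]; exists x; rewrite ?inE.
  by move: x'P; rewrite !inE /= eqxx andbT => /andP[-> ->].
have : (#|P| * #|P| = #|up| + #|down| + #|diag|)%N.
  rewrite -cardsX.
  rewrite -(cardsID [set xy : 'I_n * 'I_n | xy.1 == xy.2]%SET (finset.setX P P)).
  rewrite -(cardsID [set xy : 'I_n * 'I_n | (xy.2 < xy.1)%N]%SET (_ :\: _)).
  rewrite addnC; congr (_ + _ + _)%N; apply: eq_card => -[x y]; rewrite !inE /= -?val_eqE /=.
  - by case: ltngtP; rewrite ?andbT ?andbF.
  - by case: ltngtP; rewrite ?andbT ?andbF.
  - by [].
rewrite ud dg => e; rewrite -/P.
by rewrite mulnBr muln1 e addnK addnn doubleK.
Qed.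

Lemma card_nonredundant : #|~: redundant| = response_dim T S.
Proof.
by rewrite cardsCs finset.setCK card_redundant card_prod !card_ord.
Qed.

(** The nonredundant rows already span the row space: by symmetry of each [W b], a redundant row
    equals the row of the swapped pair. *)
Lemma rank_symmetric_le (F : fieldType) nb (W : 'I_nb -> 'M[F]_n) :
  (forall b, (W b)^T = W b) ->
  (\rank (\matrix_(i, b) mxvec (mxsub tval sval (W b)) ord0 i :
     'M[F]_(#|T| * #|S|, nb)) <= response_dim T S)%N.
Proof.
move=> Wsym; rewrite -card_nonredundant; set A := \matrix_(i, b) _.
have AE t s b : A (mxvec_index t s) b = W b (tval t) (sval s).
  by rewrite mxE mxvecE mxE.
pose e (k : 'I_#|~: redundant|) := mxvec_index (enum_val k).1 (enum_val k).2.
apply: leq_trans (rank_leq_row (rowsub e A)); apply: mxrankS.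
have sub t s : (t, s) \in ~: redundant -> (row (mxvec_index t s) A <= rowsub e A)%MS.
  move=> ts; rewrite (_ : row _ _ = row (enum_rank_in ts (t, s)) (rowsub e A)) ?row_sub//.
  by rewrite row_rowsub /e enum_rankK_in.
apply/row_subP => i; case/mxvec_indexP: i => t s.
have [|] := boolP ((t, s) \in ~: redundant); first exact: sub.
rewrite !inE negbK /= => /and3P[tS sT lt].
pose t' := enum_rank_in sT (sval s); pose s' := enum_rank_in tS (tval t).
rewrite (_ : row _ _ = row (mxvec_index t' s') A).
  (* The swap reverses the strict inequality [lt], so the swapped pair is not redundant. *)
  by apply: sub; rewrite !inE /= !enum_rankK_in// ltnNge (ltnW lt) !andbF.
apply/rowP => b; rewrite !mxE -[W b in LHS]Wsym.
by rewrite !mxvecE !mxE !enum_rankK_in.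
Qed.

End symmetric_pairs.

(** * Polynomial functions and the spring network *)

Section polynomial_functions.
Context {R : comNzRingType} {n : nat}.
Implicit Types f : 'rV[R]_n -> R.

(** Asking only for some polynomial with the right values lets matrices be treated as functions of a
    point, with no polynomial written out. *)
Definition polyfun f :=
  exists F : mpoly n R, forall z : 'rV[R]_n, meval (z ord0) F = f z.

Lemma polyfun_cst c : polyfun (fun=> c).
Proof. by exists (mpolyC n c) => z; rewrite mevalC. Qed.

Lemma polyfun_coord i : polyfun (fun z : 'rV[R]_n => z ord0 i).
Proof. by exists (mpolyX R (mnm1 i)) => z; rewrite mevalXU. Qed.

Lemma polyfunD f1 f2 :
  polyfun f1 -> polyfun f2 -> polyfun (fun z => f1 z + f2 z).
Proof. by move=> [F FE] [G GE]; exists (F + G) => z; rewrite mevalD FE GE. Qed.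

Lemma polyfunM f1 f2 :
  polyfun f1 -> polyfun f2 -> polyfun (fun z => f1 z * f2 z).
Proof. by move=> [F FE] [G GE]; exists (F * G) => z; rewrite mevalM FE GE. Qed.

Lemma polyfunN f : polyfun f -> polyfun (fun z => - f z).
Proof. by move=> [F FE]; exists (- F) => z; rewrite mevalN FE. Qed.

Lemma polyfun_sum (I : Type) (r : seq I) (P : pred I) (f : I -> 'rV[R]_n -> R) :
  (forall i, polyfun (f i)) -> polyfun (fun z => \sum_(i <- r | P i) f i z).
Proof.
move=> pf; rewrite -fct_sumE; elim/big_ind : _ => //; first exact: polyfun_cst.
by move=> f1 f2; exact: polyfunD.
Qed.

Lemma polyfun_prod (I : Type) (r : seq I) (P : pred I) (f : I -> 'rV[R]_n -> R) :
  (forall i, polyfun (f i)) -> polyfun (fun z => \prod_(i <- r | P i) f i z).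
Proof.
move=> pf; rewrite -fct_prodE; elim/big_ind : _ => //; first exact: polyfun_cst.
by move=> f1 f2; exact: polyfunM.
Qed.

Definition polymx {p q} (M : 'rV[R]_n -> 'M[R]_(p, q)) :=
  forall i j, polyfun (fun z => M z i j).

Lemma polymx_mul p q r (A : 'rV[R]_n -> 'M[R]_(p, q)) (B : 'rV[R]_n -> 'M[R]_(q, r)) :
  polymx A -> polymx B -> polymx (fun z => A z *m B z).
Proof.
move=> pA pB i j; under eq_fun do rewrite mxE.
by apply: polyfun_sum => k; exact: polyfunM.
Qed.

Lemma polyfun_det p (M : 'rV[R]_n -> 'M[R]_p) :
  polymx M -> polyfun (fun z => \det (M z)).
Proof.
move=> pM; apply: polyfun_sum => s; apply: polyfunM; first exact: polyfun_cst.
by apply: polyfun_prod => i; exact: pM.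
Qed.

Lemma polymx_adj p (M : 'rV[R]_n -> 'M[R]_p) :
  polymx M -> polymx (fun z => \adj (M z)).
Proof.
move=> pM i j; under eq_fun do rewrite mxE.
apply: polyfunM; first exact: polyfun_cst.
by apply: polyfun_det => k l; under eq_fun do rewrite !mxE; exact: pM.
Qed.

End polynomial_functions.

(** * The response Jacobian and its polynomial numerator *)

Section spring_network.
Context {R : realType} {N nb : nat}.
Variables (g : graph N nb) (pinned : {set 'I_(N * 2)}).
Implicit Types (X : 'rV[R]_(N * 2)) (kappa : 'rV[R]_nb) (b : 'I_nb).
Local Notation fval := (@enum_val _ (mem (~: pinned))).
Local Notation Kff := (free_stiffness g pinned).

(** The Q_b of the overview, the coefficient of kappa_b in K_ff. *)
Definition bond_mx X b : 'M[R]_#|~: pinned| :=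
  mxsub fval fval (bond_vec g X b *m (bond_vec g X b)^T).

Lemma bond_mx_sym X b : (bond_mx X b)^T = bond_mx X b.
Proof. by rewrite /bond_mx trmx_mxsub trmx_mul trmxK. Qed.

Lemma free_stiffnessE X kappa :
  Kff X kappa = \sum_b kappa ord0 b *: bond_mx X b.
Proof.
apply/matrixP => i j; rewrite mxE /stiffness !summxE.
by apply: eq_bigr => b _; rewrite [LHS]mxE [RHS]mxE; congr (_ * _); rewrite [RHS]mxE.
Qed.

Lemma free_stiffness_sym X kappa : (Kff X kappa)^T = Kff X kappa.
Proof.
rewrite free_stiffnessE raddf_sum; apply: eq_bigr => b _.
by rewrite /= linearZ /= bond_mx_sym.
Qed.

Lemma differentiable_free_stiffness X kappa : differentiable (Kff X) kappa.
Proof.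
apply/differentiable_mxP => i j.
rewrite (_ : (fun _ => _) = fun k : 'rV[R]_nb => \sum_b k ord0 b * bond_mx X b i j).
  apply: differentiable_bigsum => b _; apply: differentiableM.
    exact: differentiable_coord.
  exact: differentiable_cst.
apply/funext => k; rewrite free_stiffnessE summxE.
by apply: eq_bigr => b _; rewrite mxE.
Qed.

(** K_ff is linear in [kappa], hence its own differential, which is evaluated here at a basis
    vector. *)
Lemma derive_free_stiffness X kappa b :
  'D_(delta_mx ord0 b) (Kff X) kappa = bond_mx X b.
Proof.
have lin : linear (Kff X).
  move=> a k l; rewrite !free_stiffnessE scaler_sumr -big_split /=.
  by apply: eq_bigr => c _; rewrite !mxE scalerDl scalerA.
pose L : {linear 'rV[R]_nb -> 'M[R]_#|~: pinned|} :=
  HB.pack (Kff X) (GRing.isLinear.Build _ _ _ _ _ lin).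
rewrite deriveE; last exact: differentiable_free_stiffness.
rewrite -[Kff X]/(L : _ -> _) diff_lin; last first.
  by move=> k; apply: differentiable_continuous; exact: differentiable_free_stiffness.
rewrite /= free_stiffnessE (bigD1 b)//= big1 ?addr0 ?mxE ?eqxx ?scale1r//.
by move=> c cb; rewrite mxE eqxx /= (negPf cb) scale0r.
Qed.

Definition adj_bond_mx X kappa b : 'M[R]_#|~: pinned| :=
  \adj (Kff X kappa) *m bond_mx X b *m \adj (Kff X kappa).

Lemma adj_bond_mx_sym X kappa b : (adj_bond_mx X kappa b)^T = adj_bond_mx X kappa b.
Proof.
by rewrite /adj_bond_mx !trmx_mul trmx_adj free_stiffness_sym bond_mx_sym mulmxA.
Qed.

Variables T S : {set 'I_#|~: pinned|}.
Local Notation tval := (@enum_val _ (mem T)).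
Local Notation sval := (@enum_val _ (mem S)).

(** The polynomial matrix M of the overview. *)
Definition jacobian_numerator X kappa : 'M[R]_(#|T| * #|S|, nb) :=
  \matrix_(i, b) mxvec (mxsub tval sval (adj_bond_mx X kappa b)) ord0 i.

Lemma response_jacobianE X kappa : Kff X kappa \in unitmx ->
  response_jacobian g T S X kappa =
  - (\det (Kff X kappa)) ^- 2 *: jacobian_numerator X kappa.
Proof.
move=> uK; have dK := differentiable_free_stiffness X kappa.
have dC := differentiable_invmx _ _ _ dK uK.
pose f k := mxvec (response g T S X k).
have fE k t s : f k ord0 (mxvec_index t s) = invmx (Kff X k) (tval t) (sval s).
  by rewrite /f mxvecE mxE.
have df : differentiable f kappa.
  apply/differentiable_mxP => i j; rewrite (ord1 i).
  case/mxvec_indexP: j => t s; under eq_fun do rewrite fE.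
  by move/differentiable_mxP : dC; exact.
apply/matrixP => i b; case/mxvec_indexP: i => t s.
rewrite [LHS]mxE [RHS]mxE [X in _ * X]mxE [in RHS]mxvecE [X in _ * X]mxE.
(* Row [b] of the untransposed Jacobian is the derivative in the direction of the [b]-th basis
   vector. *)
transitivity (((delta_mx ord0 b : 'rV[R]_nb) *m jacobian f kappa) ord0 (mxvec_index t s)).
  by rewrite -rowE [RHS]mxE.
rewrite -deriveEjacobian// -derive_entry; last exact: diff_derivable.
under eq_fun do rewrite fE.
rewrite derive_entry; last exact: diff_derivable.
rewrite derive_invmx// derive_free_stiffness /invmx uK.
rewrite -scalemxAl -scalemxAl -scalemxAr scalerA /adj_bond_mx.
by rewrite [LHS]mxE [X in - X]mxE mulNr -exprVn expr2.
Qed.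

Lemma rank_response_jacobian X kappa : Kff X kappa \in unitmx ->
  \rank (response_jacobian g T S X kappa) = \rank (jacobian_numerator X kappa).
Proof.
move=> uK; rewrite response_jacobianE// eqmx_scale//.
by rewrite oppr_eq0 invr_eq0 expf_eq0 /= -unitfE -unitmxE.
Qed.

Lemma rank_jacobian_numerator_le X kappa :
  (\rank (jacobian_numerator X kappa) <= minn nb (response_dim T S))%N.
Proof.
rewrite leq_min rank_leq_col /=; apply: rank_symmetric_le => b.
exact: adj_bond_mx_sym.
Qed.

Lemma polymx_bond_mx b :
  polymx (fun z : 'rV[R]_(N * 2 + nb) => bond_mx (lsubmx z) b).
Proof.
have pv : polymx (fun z : 'rV[R]_(N * 2 + nb) => bond_vec g (lsubmx z) b).
  move=> k c; rewrite (ord1 c) /bond_vec; case: (g b) => i j.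
  case/mxvec_indexP: k => k a.
  under eq_fun do rewrite mxE mxvecE mxE.
  (* In turn: the block at node [i], the block at node [j], and the zero blocks. *)
  case: (k == i); last case: (k == j).
  - under eq_fun do rewrite !mxE.
    by apply/polyfunN/polyfunD; last apply/polyfunN; exact: polyfun_coord.
  - under eq_fun do rewrite !mxE.
    by apply/polyfunD; last apply/polyfunN; exact: polyfun_coord.
  - by under eq_fun do rewrite mxE; exact: polyfun_cst.
move=> i j; under eq_fun do rewrite mxE.
apply: polymx_mul; first exact: pv.
by move=> k l; under eq_fun do rewrite mxE; exact: pv.
Qed.

Lemma polymx_free_stiffness :
  polymx (fun z : 'rV[R]_(N * 2 + nb) => Kff (lsubmx z) (rsubmx z)).
Proof.
move=> i j; under eq_fun do rewrite free_stiffnessE summxE.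
apply: polyfun_sum => b; under eq_fun do rewrite mxE [rsubmx _ _ _]mxE.
by apply: polyfunM; [exact: polyfun_coord|exact: polymx_bond_mx].
Qed.

Lemma polymx_jacobian_numerator :
  polymx (fun z : 'rV[R]_(N * 2 + nb) => jacobian_numerator (lsubmx z) (rsubmx z)).
Proof.
move=> i b; case/mxvec_indexP: i => t s; under eq_fun do rewrite mxE mxvecE mxE.
have pa := polymx_adj _ _ polymx_free_stiffness.
have pab := polymx_mul _ _ _ _ _ pa (polymx_bond_mx b).
exact: (polymx_mul _ _ _ _ _ pab pa (tval t) (sval s)).
Qed.

End spring_network.

Theorem proposition14 (R : realType) (N nb : nat) (g : graph N nb)
    (pinned : {set 'I_(N * 2)}) (T S : {set 'I_#|~: pinned|})
    (card_pinned : #|pinned| = 3%N)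
    (X0 : 'rV[R]_(N * 2)) (kappa0 : 'rV[R]_nb)
    (adm0 : admissible g pinned X0 kappa0)
    (rank0 : \rank (response_jacobian g T S X0 kappa0) =
             minn nb (response_dim T S)) :
  exists F : mpoly (N * 2 + nb) R,
    [/\ F != 0,
        (forall (X : 'rV[R]_(N * 2)) (kappa : 'rV[R]_nb),
           admissible g pinned X kappa ->
           meval (row_mx X kappa ord0) F != 0 ->
           \rank (response_jacobian g T S X kappa) =
           minn nb (response_dim T S)),
        lebesgue_null (zero_locus F) &
        interior (zero_locus F) = set0].
Proof.
have [_ uK0] := adm0; rewrite (rank_response_jacobian _ _ _ _ _ _ uK0) in rank0.
have [f [h minor0]] := minor_of_rank _ _ _ _ _ rank0.
(* The rows [f] and columns [h] found at the base point stay fixed while the point [z], positions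
   followed by stiffnesses, varies. *)
have [F FE] : polyfun (fun z : 'rV[R]_(N * 2 + nb) =>
    \det (mxsub f h (jacobian_numerator g pinned T S (lsubmx z) (rsubmx z)))).
  apply: polyfun_det => i j; under eq_fun do rewrite mxE.
  exact: polymx_jacobian_numerator.
have F0 : meval (row_mx X0 kappa0 ord0) F != 0 by rewrite FE row_mxKl row_mxKr.
exists F; split.
- by apply: contra_neq F0 => ->; rewrite meval0.
- move=> X kappa [_ uK]; rewrite FE row_mxKl row_mxKr => minor.
  rewrite (rank_response_jacobian _ _ _ _ _ _ uK).
  (* The upper bound holds everywhere by symmetry; the nonvanishing minor gives the lower one. *)
  apply/eqP; rewrite eqn_leq rank_jacobian_numerator_le.
  exact: rank_ge_minor minor.
- exact: lebesgue_null_zero_locus F0.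
- exact: interior_zero_locus F0.
Qed.
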